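(* Let $R$ be an integral domain with field of fractions $F$, let $f,g\in R[X]$ be monic polynomials of degree $n\ge 1$ with companion matrices $C,D\in M_n(R)$, let $d=\gcd(f,g)\in F[X]$ and $h=f/d$. Suppose $d\in R[X]$. Let $P_1,\dots,P_{n-1}\in R[X,Y]$ be arbitrary polynomials satisfying $$D^jC=P_j(C,D),\qquad j=1,\dots,n-1.$$ Then the $R$-algebra $R\langle C,D\rangle$ has presentation $$\langle X,Y\mid f(X)=0,\ g(Y)=0,\ h(X)(X-Y)=0,\ Y^jX=P_j(X,Y),\ j=1,\dots,n-1\rangle,$$ with $X$ corresponding to $C$ and $Y$ to $D$.
   Context: For monic $f=f_0+f_1X+\cdots+f_{n-1}X^{n-1}+X^n\in R[X]$ the companion matrix $C_f\in M_n(R)$ has $1$'s on the first subdiagonal, last column $(-f_0,\dots,-f_{n-1})^T$, and $0$'s elsewhere. $R\langle C,D\rangle$ is the unital $R$-subalgebra of $M_n(R)$ generated by $C$ and $D$. The gcd is monic and taken in $F[X]$; if $d\in R[X]$ then also $h\in R[X]$. For $P=\sum a_{kl}X^kY^l\in R[X,Y]$ and elements $A,B$ of a (noncommutative) $R$-algebra, $P(A,B)$ means $\sum a_{kl}A^kB^l$ (powers of $A$ on the left). The presentation is as an associative unital $R$-algebra, i.e. as a quotient of the free algebra $R\langle X,Y\rangle$ by the two-sided ideal generated by the relations. *)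

(* Defs.v *)
From HB Require Import structures.
From mathcomp Require Import all_boot all_order all_algebra.
From mathcomp.multinomials Require Import monalg.

Set Implicit Arguments.
Unset Strict Implicit.
Unset Printing Implicit Defensive.

Import GRing.Theory.
Local Open Scope ring_scope.

(* The free unital associative algebra, as the monoid algebra of the free monoid
   of words over [I]. *)
Definition free_alg (R : comNzRingType) (I : choiceType) : Type :=
  {malg R[{fmonom I}]}.

(* For a noncommutative monoid [K], multinomials declares [{malg R[K]}] only as
   a left algebra; [horner_alg] needs the scalars to be central. *)
Section FreeAlgAlgebra.
Variables (R : comNzRingType) (I : choiceType).

HB.instance Definition _ :=
  GRing.Lalgebra.copy (free_alg R I) {malg R[{fmonom I}]}.

Fact free_alg_scalerAr (c : R) (u v : free_alg R I) :
  c *: (u * v) = u * (c *: v).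
Proof.
have cC (w : {malg R[{fmonom I}]}) : c%:MP * w = w * c%:MP.
  rewrite (monalgE w) mulr_sumr mulr_suml; apply: eq_bigr => k _.
  rewrite [LHS]fgmulUU [RHS]fgmulUU.
  by rewrite mulrC mul1m mulm1.
transitivity (c%:MP * ((u : {malg R[{fmonom I}]}) * v)).
  by rewrite mul_malgC.
by rewrite mulrA cC -mulrA mul_malgC.
Qed.

HB.instance Definition _ :=
  GRing.Lalgebra_isAlgebra.Build R (free_alg R I) free_alg_scalerAr.
End FreeAlgAlgebra.

Definition free_var {R : comNzRingType} {I : choiceType} (i : I) :
  free_alg R I := << fmu i >>.

Definition word_eval {R : comNzRingType} {I : choiceType} {A : algType R}
    (a : I -> A) (w : {fmonom I}) : A :=
  \prod_(i <- w) a i.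

(* The unital algebra morphism from the free algebra that extends [a]. *)
Definition free_eval {R : comNzRingType} {I : choiceType} {A : algType R}
    (a : I -> A) : free_alg R I -> A :=
  mmap (in_alg A) (word_eval a).

Section FreeEvalTheory.
Variables (R : comNzRingType) (I : choiceType) (A : algType R) (a : I -> A).

Lemma free_eval_var i : free_eval a (free_var i) = a i.
Proof.
rewrite /free_eval /free_var; transitivity ((1 : R)%:A * a i).
  by apply: etrans (mmapU _ _) _; rewrite /word_eval fmuE big_seq1.
by rewrite scale1r mul1r.
Qed.

Fact word_eval_mmorphism : mmorphism (word_eval a).
Proof.
by split=> [u v|]; rewrite /word_eval ?fm1 ?big_nil // fmM big_cat.
Qed.

HB.instance Definition _ :=
  isMultiplicative.Build {fmonom I} A (word_eval a)
    word_eval_mmorphism.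

Fact free_eval_is_zmod_morphism : zmod_morphism (free_eval a).
Proof. exact: mmap_is_additive. Qed.

Fact free_eval_is_monoid_morphism : monoid_morphism (free_eval a).
Proof.
have [M1 M2] : multiplicative (mmap (in_alg A) (word_eval a)).
  apply: commr_mmap_is_multiplicative => g m m'.
  by rewrite /GRing.comm /= -scalerAl -scalerAr mul1r mulr1.
by split.
Qed.

Fact free_eval_is_scalable : scalable (free_eval a).
Proof. by move=> c u; apply: etrans (mmapZ _ _) _; rewrite mulr_algl. Qed.

HB.instance Definition _ :=
  GRing.isZmodMorphism.Build (free_alg R I) A (free_eval a)
    free_eval_is_zmod_morphism.
HB.instance Definition _ :=
  GRing.isMonoidMorphism.Build (free_alg R I) A (free_eval a)
    free_eval_is_monoid_morphism.
HB.instance Definition _ :=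
  GRing.isScalable.Build R (free_alg R I) A *:%R (free_eval a)
    free_eval_is_scalable.

End FreeEvalTheory.

Inductive subalg_gen {R : comNzRingType} {A : algType R} (S : A -> Prop) :
  A -> Prop :=
| SubalgGen x : S x -> subalg_gen S x
| SubalgScalar c : subalg_gen S c%:A
| SubalgAdd x y : subalg_gen S x -> subalg_gen S y -> subalg_gen S (x + y)
| SubalgMul x y : subalg_gen S x -> subalg_gen S y -> subalg_gen S (x * y).

Inductive ideal_gen {A : pzRingType} (S : A -> Prop) : A -> Prop :=
| IdealGen x : S x -> ideal_gen S x
| Ideal0 : ideal_gen S 0
| IdealAdd x y : ideal_gen S x -> ideal_gen S y -> ideal_gen S (x + y)
| IdealMul a x b : ideal_gen S x -> ideal_gen S (a * x * b).

(* The subalgebra [B] of [A] has presentation < I | rels >, the generator [i]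
   corresponding to [a i]: the canonical morphism from the free algebra maps
   onto [B] and its kernel is the two-sided ideal generated by [rels], i.e. it
   induces an isomorphism from the quotient by that ideal to [B]. *)
Definition has_presentation {R : comNzRingType} {I : choiceType}
    {A : algType R} (B : A -> Prop) (a : I -> A)
    (rels : free_alg R I -> Prop) : Prop :=
  (forall x, B x <-> exists w, free_eval a w = x) /\
  (forall w, free_eval a w = 0 <-> ideal_gen rels w).

Definition companion {R : nzRingType} (n : nat) (f : {poly R}) : 'M[R]_n.+1 :=
  \matrix_(i, j) if j == ord_max then - f`_i else (i == j.+1 :> nat)%:R.

(* [{poly {poly R}}] stands for R[X,Y] with Y as the outer variable, so the
   coefficient of X^k Y^l in [P] is [P`_l`_k]. *)
Definition ordered_eval {R : comNzRingType} {A : algType R}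
    (P : {poly {poly R}}) (a b : A) : A :=
  \sum_(l < size P) \sum_(k < size P`_l) P`_l`_k *: (a ^+ k * b ^+ l).

(* [gcdp] is only a gcd up to a nonzero scalar. *)
Definition monic_gcd {F : fieldType} (p q : {poly F}) : {poly F} :=
  (lead_coef (gcdp p q))^-1 *: gcdp p q.

(* The division [%/] of [{poly R}] is a pseudo-division in general; for the
   monic [d] below, [f %/ d] is the quotient f / d of F[X]. *)
Lemma map_divp_monic_gcd (R : idomainType) (f g d : {poly R}) :
  f \is monic ->
  map_poly (@tofrac R) d = monic_gcd (map_poly (@tofrac R) f) (map_poly (@tofrac R) g) ->
  map_poly (@tofrac R) (f %/ d) = map_poly (@tofrac R) f %/ map_poly (@tofrac R) d.
Proof.
move=> mon_f def_d; set F := map_poly (@tofrac R).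
have inj : injective (@tofrac R) by move=> x y /eqP; rewrite tofrac_eq => /eqP.
have szF p : size (F p) = size p.
  by rewrite size_map_inj_poly ?rmorph0 //.
have nz_gcd : gcdp (F f) (F g) != 0.
  by rewrite gcdp_eq0 negb_and -size_poly_gt0 szF size_poly_gt0 monic_neq0.
have lead_d : (@tofrac R) (lead_coef d) = 1.
  rewrite -(lead_coef_map_inj inj) ?rmorph0 // def_d.
  by rewrite /monic_gcd lead_coefZ mulVf // lead_coef_eq0.
have mon_d : d \is monic.
  by apply/eqP/inj; rewrite lead_d rmorph1.
have nz_Fd : F d != 0 by rewrite -size_poly_gt0 szF size_poly_gt0 monic_neq0.
have := Pdiv.IdomainMonic.divp_eq mon_d f.
move/(congr1 F); rewrite /F rmorphD rmorphM /= -/F => fE.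
rewrite [in RHS]fE divpD mulpK //.
by rewrite [X in _ + X]divp_small ?addr0 // !szF ltn_modp monic_neq0.
Qed.

(* The free generators X and Y are indexed by [false] and [true]. *)
Definition relators {R : idomainType} (n : nat) (f g h : {poly R})
    (P : nat -> {poly {poly R}}) (w : free_alg R bool) : Prop :=
  let X := free_var false in
  let Y := free_var true in
  [\/ w = horner_alg X f,
      w = horner_alg Y g,
      w = horner_alg X h * (X - Y)
    | exists2 j, (0 < j < n)%N & w = Y ^+ j * X - ordered_eval (P j) X Y].

(* Main.v *)
Require Import Defs.
From HB Require Import structures.
From mathcomp Require Import all_boot all_order all_algebra.
From mathcomp Require Import zify.
From mathcomp.multinomials Require Import monalg.

Set Implicit Arguments.
Unset Strict Implicit.
Unset Printing Implicit Defensive.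

Import GRing.Theory.
Local Open Scope ring_scope.

(** Write n + 1 for the degree of f and g. That C and D satisfy the relations
    is seen by letting C act on R[X]/(f), and D on R[X]/(g), in the basis
    1, X, ..., X^n: both send each X^i with i < n to X^(i+1), so C - D is zero
    outside its last column, which is the class of g - f modulo f. Hence
    h(C) (C - D) has last column the class of h (g - f), which f divides since
    h g = f (g / d).

    Conversely, let w be in the kernel of the evaluation at (C, D). Modulo the
    relations, w is congruent to an ordered combination of the b_l(X) Y^l with
    l <= n: right multiplication by Y preserves such combinations because
    g(Y) = 0, and right multiplication by X does because Y^l X is P_l(X, Y)
    ([subalg_gen_ordered]). Moreover h(X) (X - Y) = 0 gives
    h(X) Y^l = h(X) X^l, so every b_l with l > 0 can be reduced modulo h at the
    cost of changing b_0, which is finally reduced modulo f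
    ([ordered_eval_normal]).

    It remains to see that a normal form B whose value M = sum_l b_l(C) D^l is
    zero is itself zero ([ordered_eval_companion_inj]). As b_l(C) commutes with
    C, the matrix M D - C M equals sum_l b_l(C) (D - C) D^l. For a column v,
    (D - C) v is v_n times the class of f - g, and the last coordinate of
    D^l X^i is 0 if l + i < n and 1 if l + i = n. Reading the columns
    i = 0, ..., n - 1 in this order therefore yields that f divides b_l g for
    l = n, ..., 1 successively. Since h and g / d are coprime over the
    fractions, h then divides b_l ([divp_monic_gcd_cancel]), and b_l = 0 for
    reasons of degree. Finally b_0(C) = 0 gives b_0 = 0, by applying it to the
    class of 1. *)

(** * Ordered evaluation of bivariate polynomials *)

Section OrderedEval.
Variables (R : comNzRingType) (A : algType R) (x y : A).
Implicit Types (B : {poly {poly R}}) (p q : {poly R}).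

(** The coefficients of [horner] stand to the left of the powers of the
    variable, so that ordered evaluation is a Horner evaluation over [A]. *)
Lemma ordered_evalE B :
  ordered_eval B x y = (map_poly (horner_alg x) B).[y].
Proof.
rewrite (horner_coef_wide _ (size_poly _ _)) /ordered_eval.
apply: eq_bigr => l _; rewrite coef_map /=.
rewrite -[in RHS](coefK B`_l) poly_def raddf_sum mulr_suml /=.
apply: eq_bigr => k _.
by rewrite linearZ /= rmorphXn /= horner_algX mulr_algl scalerAl.
Qed.

Lemma ordered_eval_sum m B : (size B <= m)%N ->
  ordered_eval B x y = \sum_(l < m) horner_alg x B`_l * y ^+ l.
Proof.
move=> szB; rewrite ordered_evalE (@horner_coef_wide _ m).
  by apply: eq_bigr => l _; rewrite coef_map.
exact: leq_trans (size_poly _ _) szB.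
Qed.

Lemma ordered_evalD B B' :
  ordered_eval (B + B') x y = ordered_eval B x y + ordered_eval B' x y.
Proof. by rewrite !ordered_evalE rmorphD hornerD. Qed.

Lemma ordered_eval_bigD m (B : 'I_m -> {poly {poly R}}) :
  ordered_eval (\sum_l B l) x y = \sum_l ordered_eval (B l) x y.
Proof.
rewrite ordered_evalE rmorph_sum horner_sum.
by apply: eq_bigr => l _; rewrite ordered_evalE.
Qed.

Lemma ordered_evalC p : ordered_eval p%:P x y = horner_alg x p.
Proof. by rewrite ordered_evalE map_polyC hornerC. Qed.

Lemma ordered_evalMl p B :
  ordered_eval (p%:P * B) x y = horner_alg x p * ordered_eval B x y.
Proof. by rewrite !ordered_evalE rmorphM /= map_polyC hornerCM. Qed.

Lemma ordered_evalMX B :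
  ordered_eval (B * 'X) x y = ordered_eval B x y * y.
Proof. by rewrite !ordered_evalE rmorphM /= map_polyX hornerMX. Qed.

(** The coefficients of [q] are scalars, so that they commute with [y]. *)
Lemma ordered_evalMr B q :
  ordered_eval (B * map_poly polyC q) x y
    = ordered_eval B x y * horner_alg y q.
Proof.
have mapE : map_poly (horner_alg x) (map_poly polyC q) = map_poly (in_alg A) q.
  by rewrite -map_poly_comp; apply: eq_map_poly => c /=; rewrite horner_algC.
have yq : GRing.comm y (map_poly (in_alg A) q).[y].
  apply: (@commr_horner A) => // i.
  by rewrite coef_map /GRing.comm /= comm_alg.
by rewrite !ordered_evalE rmorphM /= mapE hornerM_comm //; apply: commr_sym.
Qed.

End OrderedEval.

(** * Two-sided ideals and generated subalgebras *)

Section Ideals.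
Variables (R : comNzRingType) (A : algType R) (S : A -> Prop).
Local Notation J := (ideal_gen S).

Lemma ideal_genMl a u : J u -> J (a * u).
Proof. by move=> Ju; rewrite -[a * u]mulr1; apply: IdealMul. Qed.

Lemma ideal_genMr b u : J u -> J (u * b).
Proof. by move=> Ju; rewrite -[u]mul1r; apply: IdealMul. Qed.

Lemma ideal_genN u : J u -> J (- u).
Proof. by rewrite -mulN1r; exact: ideal_genMl. Qed.

Lemma ideal_gen_sum m (u : 'I_m -> A) : (forall i, J (u i)) -> J (\sum_i u i).
Proof.
by move=> Ju; elim/big_ind: _ => //; [exact: Ideal0 | exact: IdealAdd].
Qed.

Lemma ideal_gen_trans v u w : J (u - v) -> J (v - w) -> J (u - w).
Proof. by move=> Juv Jvw; rewrite -(subrKA v); apply: IdealAdd. Qed.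

End Ideals.

Lemma ideal_gen_ker (A B : pzRingType) (S : A -> Prop)
    (phi : {rmorphism A -> B}) :
  (forall u, S u -> phi u = 0) -> forall u, ideal_gen S u -> phi u = 0.
Proof.
move=> S0 u; elim=> {u} [u /S0 // | | u v _ u0 _ v0 | a u b _ u0].
- exact: rmorph0.
- by rewrite rmorphD u0 v0 addr0.
- by rewrite !rmorphM u0 mulr0 mul0r.
Qed.

Lemma subalg_gen_sum (R : comNzRingType) (A : algType R) (S : A -> Prop)
    (I : Type) (r : seq I) (u : I -> A) :
  (forall i, subalg_gen S (u i)) -> subalg_gen S (\sum_(i <- r) u i).
Proof.
move=> Su; elim/big_ind: _ => //; last exact: SubalgAdd.
by rewrite -(scale0r (1 : A)); apply: SubalgScalar.
Qed.

Lemma free_alg_gen (R : comNzRingType) (I : choiceType) (w : free_alg R I) :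
  subalg_gen (fun u => exists i, u = free_var i) w.
Proof.
have word (s : seq I) :
    subalg_gen (fun u : free_alg R I => exists i, u = free_var i)
      (<< FMonom s >> : free_alg R I).
  elim: s => [|i s IHs].
    have -> : (<< FMonom [::] >> : free_alg R I) = 1%:A.
      by rewrite scale1r -fmoneE.
    exact: SubalgScalar.
  have -> : (<< FMonom (i :: s) >> : free_alg R I)
      = free_var i * (<< FMonom s >> : free_alg R I).
    apply/esym; rewrite /free_var; apply: etrans (fgmulUU _ _ _ _) _.
    by rewrite mulr1; congr << _ >>; rewrite fmuE; exact: fmmulE.
  by apply: SubalgMul => //; apply: SubalgGen; exists i.
rewrite (monalgE w); apply: subalg_gen_sum => k.
have -> : (<< w@_k *g k >> : free_alg R I)
    = (w@_k)%:A * (<< k >> : free_alg R I).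
  rewrite mulr_algl; apply/malgP => k'.
  by apply/esym/(etrans (mcoeffZ _ _ _)); rewrite !mcoeffU mulrnAr mulr1.
by apply: SubalgMul; [exact: SubalgScalar | case: k => s; exact: word].
Qed.
(** * Reduction to normal form modulo the relations *)

(** The normal form of an element of the presented algebra: a combination of
    the X^k Y^l with l < m, where k < m for l = 0 and k is less than the degree
    of h for l > 0. *)
Definition normal_poly (R : nzRingType) (m : nat) (h : {poly R})
    (B : {poly {poly R}}) : Prop :=
  [/\ (size B <= m)%N, (size (B`_0)%R <= m)%N
    & forall l, (0 < l)%N -> (size (B`_l)%R < size h)%N].

Section NormalForm.
Variables (R : idomainType) (A : algType R) (S : A -> Prop) (x y : A).
Variables (n : nat) (f g h : {poly R}) (P : nat -> {poly {poly R}}).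
Local Notation J := (ideal_gen S).
Local Notation ev B := (ordered_eval B x y).

Hypotheses (f_monic : f \is monic) (size_f : size f = n.+2).
Hypotheses (g_monic : g \is monic) (size_g : size g = n.+2).
Hypothesis h_monic : h \is monic.
Hypothesis fx : J (horner_alg x f).
Hypothesis gy : J (horner_alg y g).
Hypothesis hxy : J (horner_alg x h * (x - y)).
Hypothesis yx : forall j, (0 < j < n.+1)%N -> J (y ^+ j * x - ev (P j)).

(** The relation g(Y) = 0 bounds the degree in Y: [B] is divided by g(Y), as a
    monic polynomial in Y over R[X]. *)
Lemma ordered_eval_truncate B :
  exists2 B' : {poly {poly R}}, (size B' <= n.+1)%N & J (ev B - ev B').
Proof.
pose G := map_poly polyC g; pose Q := Pdiv.Ring.rdivp B G.
have G_monic : G \is monic by exact: monic_map.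
exists (Pdiv.Ring.rmodp B G).
  have := Pdiv.Ring.ltn_rmodp B G.
  by rewrite monic_neq0 // size_map_polyC size_g ltnS => ->.
rewrite {1}[B](Pdiv.RingMonic.rdivp_eq G_monic) ordered_evalD addrK.
by rewrite ordered_evalMr; apply: ideal_genMl.
Qed.

Lemma ordered_evalMx B : exists B', J (ev B * x - ev B').
Proof.
have [B1 szB1 JB1] := ordered_eval_truncate B.
pose Q (l : 'I_n.+1) := if l == 0%N :> nat then 'X%:P else P l.
exists (\sum_(l < n.+1) (B1`_l)%:P * Q l).
apply: (@ideal_gen_trans _ _ _ (ev B1 * x)).
  by rewrite -mulrBl; apply: ideal_genMr.
rewrite (ordered_eval_sum _ _ szB1) ordered_eval_bigD mulr_suml -sumrB.
apply: ideal_gen_sum => l; rewrite ordered_evalMl -mulrA -mulrBr.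
apply: ideal_genMl; rewrite /Q; case: eqP => [-> | /eqP l0].
  by rewrite ordered_evalC horner_algX mul1r subrr; apply: Ideal0.
by apply: yx; rewrite lt0n l0 /=.
Qed.

Lemma subalg_gen_ordered w :
  subalg_gen (fun u => u = x \/ u = y) w -> exists B, J (w - ev B).
Proof.
(* The induction is on the right factor of a product with an ordered element. *)
suff mul_ev : subalg_gen (fun u => u = x \/ u = y) w ->
    forall B, exists B', J (ev B * w - ev B').
  by move=> /mul_ev/(_ 1); rewrite [ev 1]ordered_evalC rmorph1 mul1r.
elim=> {w} [u [] -> B | c B | u v _ IHu _ IHv B | u v _ IHu _ IHv B].
- exact: ordered_evalMx.
- by exists (B * 'X); rewrite ordered_evalMX subrr; apply: Ideal0.
- exists (B * map_poly polyC c%:P).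
  by rewrite ordered_evalMr horner_algC subrr; apply: Ideal0.
- have [[Bu Ju] [Bv Jv]] := (IHu B, IHv B); exists (Bu + Bv).
  by rewrite mulrDr ordered_evalD opprD addrACA; apply: IdealAdd.
- have [Bu Ju] := IHu B; have [Bv Jv] := IHv Bu; exists Bv.
  apply: ideal_gen_trans Jv.
  by rewrite mulrA -mulrBl; apply: ideal_genMr.
Qed.

(** The relation h(X)(X - Y) = 0 lets Y be replaced by X behind h(X). *)
Lemma horner_alg_swap l : J (horner_alg x h * (y ^+ l - x ^+ l)).
Proof.
elim: l => [|l IHl]; first by rewrite subrr mulr0; apply: Ideal0.
have hx : horner_alg x h * x ^+ l = x ^+ l * horner_alg x h.
  have -> : x ^+ l = horner_alg x 'X^l by rewrite rmorphXn /= horner_algX.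
  by rewrite -!rmorphM mulrC.
have -> : y ^+ l.+1 - x ^+ l.+1 = (y ^+ l - x ^+ l) * y - x ^+ l * (x - y).
  by rewrite mulrBl mulrBr !exprSr opprB addrA subrK.
rewrite mulrBr !mulrA hx -!mulrA mulrA; apply: IdealAdd.
  exact: ideal_genMr.
by apply/ideal_genN/ideal_genMl.
Qed.

Lemma ordered_eval_normal B :
  exists2 B', normal_poly n.+1 h B' & J (ev B - ev B').
Proof.
have [B1 szB1 JB1] := ordered_eval_truncate B.
(* For l > 0 the part of b_l that h divides moves from Y^l to X^l, hence into
   the coefficient of Y^0. *)
pose low (l : 'I_n.+1) :=
  if l == 0%N :> nat then B1`_l else B1`_l %/ h * h * 'X^l.
pose high l := if l == 0%N then 0 else B1`_l %% h.
pose B' := ((\sum_l low l) %% f)%:P + \poly_(l < n.+1) high l.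
have szhigh : (size (\poly_(l < n.+1) high l) <= n.+1)%N by apply: size_poly.
have ltmod (p q : {poly R}) : q \is monic -> (size (p %% q)%R < size q)%N.
  by move=> ?; rewrite ltn_modp monic_neq0.
exists B'.
  split=> [||l l_gt0].
  - rewrite (leq_trans (size_polyD _ _)) // geq_max szhigh andbT.
    by rewrite (leq_trans (size_polyC_leq1 _)).
  - by rewrite coefD coefC coef_poly /= addr0 -ltnS -size_f ltmod.
  - rewrite coefD coefC coef_poly /high (gtn_eqF l_gt0) add0r.
    case: ifP => _; first exact: ltmod.
    by rewrite size_poly0 size_poly_gt0 monic_neq0.
apply: (ideal_gen_trans JB1).
apply: (@ideal_gen_trans _ _ _
  (horner_alg x (\sum_l low l) + ev (\poly_(l < n.+1) high l))).
  rewrite (ordered_eval_sum _ _ szB1) (ordered_eval_sum _ _ szhigh) rmorph_sum.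
  rewrite -big_split -sumrB /=; apply: ideal_gen_sum => l.
  rewrite coef_poly ltn_ord /low /high; case: eqP => [-> | _].
    by rewrite rmorph0 mul0r addr0 mulr1 subrr; apply: Ideal0.
  rewrite {1}(Pdiv.IdomainMonic.divp_eq h_monic B1`_l) rmorphD mulrDl.
  rewrite opprD addrACA subrr addr0 !rmorphM /= rmorphXn /= horner_algX.
  rewrite -!mulrA -!mulrBr.
  by apply: ideal_genMl; apply: horner_alg_swap.
rewrite ordered_evalD ordered_evalC opprD addrACA subrr addr0 -rmorphB.
rewrite {1}(Pdiv.IdomainMonic.divp_eq f_monic (\sum_l low l)) addrK rmorphM.
exact: ideal_genMl.
Qed.

End NormalForm.

(** * Companion matrices *)

(** The column of the coefficients of degree at most [n] of [p]; for [p] of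
    degree at most [n], these are the coordinates of the class of [p] in the
    basis 1, X, ..., X^n of R[X]/(f), for any monic [f] of degree [n.+1]. *)
Definition poly_cV (R : nzRingType) (n : nat) (p : {poly R}) : 'cV[R]_n.+1 :=
  \col_i p`_i.

Section PolyCV.
Variables (R : comNzRingType) (n : nat).
Local Notation cV := (@poly_cV R n).
Implicit Types p q : {poly R}.

Lemma poly_cV0 : cV 0 = 0.
Proof. by apply/colP => i; rewrite !mxE coef0. Qed.

Lemma poly_cVD p q : cV (p + q) = cV p + cV q.
Proof. by apply/colP => i; rewrite !mxE coefD. Qed.

Lemma poly_cVZ c p : cV (c *: p) = c *: cV p.
Proof. by apply/colP => i; rewrite !mxE coefZ. Qed.

Lemma poly_cV_eq0 p : (size p <= n.+1)%N -> cV p = 0 -> p = 0.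
Proof.
move=> szp /colP p0; apply/polyP => i; rewrite coef0.
have [lt_i | le_i] := ltnP i n.+1; last by rewrite nth_default ?(leq_trans szp).
by have := p0 (Ordinal lt_i); rewrite !mxE.
Qed.

Lemma mulmx_poly_cV_inj (A B : 'M[R]_n.+1) :
  (forall i : 'I_n.+1, A *m cV 'X^i = B *m cV 'X^i) -> A = B.
Proof.
have cVXn (i : 'I_n.+1) : cV 'X^i = delta_mx i 0.
  by apply/matrixP => j k; rewrite !mxE coefXn ord1 andbT.
move=> eqAB; apply/matrixP => i j; have := eqAB j.
by rewrite cVXn -!colE => /colP/(_ i); rewrite !mxE.
Qed.

(** For monic [f] of degree [n.+1] and [p] of degree at most [n], the right-hand
    side is the column of X p modulo [f]. *)
Lemma companion_mul_poly_cV (f p : {poly R}) :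
  companion n f *m cV p = cV (p * 'X - p`_n *: f).
Proof.
apply/colP => i; rewrite !mxE big_ord_recr /= !mxE eqxx coefB coefMX coefZ.
rewrite mulNr [f`_i * _]mulrC; congr (_ - _).
under eq_bigr => j _ do rewrite !mxE -(inj_eq val_inj) /= ltn_eqF //.
case: i => -[|i] lt_i /=.
  by apply: big1 => j _; rewrite mul0r.
rewrite (bigD1 (Ordinal (lt_i : i < n)%N)) //= eqxx mul1r big1 ?addr0 // => j.
rewrite -(inj_eq val_inj) /= eqSS eq_sym => /negbTE ->.
by rewrite mul0r.
Qed.

Lemma companion_sub_poly_cV (f g p : {poly R}) :
  (companion n g - companion n f) *m cV p = p`_n *: cV (f - g).
Proof.
rewrite mulmxBl !companion_mul_poly_cV; apply/colP => i.
by rewrite !mxE !coefB !coefZ opprB addrC addrA subrK mulrBr.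
Qed.

End PolyCV.

Section MonicCompanion.
Variables (R : idomainType) (n : nat) (f : {poly R}).
Hypotheses (f_monic : f \is monic) (size_f : size f = n.+2).
Local Notation cV := (@poly_cV R n).
Implicit Types p q : {poly R}.
Local Notation C := (companion n f).

Let f_unit : lead_coef f \is a GRing.unit.
Proof. by rewrite (monicP f_monic) unitr1. Qed.

Lemma size_modp_monic p : (size (p %% f)%R <= n.+1)%N.
Proof. by rewrite -ltnS -size_f ltn_modp monic_neq0. Qed.

Lemma companion_mul_modp p : C *m cV (p %% f) = cV ((p * 'X) %% f).
Proof.
rewrite companion_mul_poly_cV; congr cV.
set r : {poly R} := p %% f.
apply: (Pdiv.IdomainUnit.modpP f_unit (q:=p %/ f * 'X + (r`_n)%:P)).
  rewrite {1}(Pdiv.IdomainMonic.divp_eq f_monic p) -/r mulrDl mulrDl mul_polyC.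
  by rewrite addrA addrAC addrK mulrAC.
rewrite size_f ltnS; apply/leq_sizeP => j; rewrite leq_eqVlt.
rewrite coefB coefMX coefZ => /predU1P[<- | lt_j] /=.
  have /monicP := f_monic; rewrite lead_coefE size_f => ->.
  by rewrite mulr1 subrr.
rewrite [f`_j]nth_default ?size_f // mulr0 subr0; case: j lt_j => // j lt_j.
by rewrite nth_default // (leq_trans (size_modp_monic p)).
Qed.

Lemma horner_companion_mul_modp q p :
  horner_alg C q *m cV (p %% f) = cV ((q * p) %% f).
Proof.
elim/poly_ind: q p => [|q c IHq] p.
  by rewrite rmorph0 !mul0r mod0p mul0mx poly_cV0.
rewrite rmorphD rmorphM /= horner_algX horner_algC.
rewrite mulmxDl -mulmxE -mulmxA companion_mul_modp IHq.
rewrite -scalemxAl mul1mx -poly_cVZ -poly_cVD.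
rewrite -(Pdiv.IdomainUnit.modpZl f_unit) -(Pdiv.IdomainUnit.modpD f_unit).
by rewrite mulrDl mul_polyC -mulrA ['X * p]mulrC.
Qed.

Lemma horner_companion_mul q p : (size p <= n.+1)%N ->
  horner_alg C q *m cV p = cV ((q * p) %% f).
Proof.
by move=> szp; rewrite -horner_companion_mul_modp modp_small ?size_f.
Qed.

Lemma companion_exp_mul l i : (i <= n)%N ->
  C ^+ l *m cV 'X^i = cV ('X^(l + i) %% f).
Proof.
move=> le_in; rewrite exprD -horner_companion_mul ?size_polyXn //.
by rewrite rmorphXn /= horner_algX.
Qed.

Lemma horner_companion : horner_alg C f = 0.
Proof.
apply: mulmx_poly_cV_inj => i; rewrite mul0mx horner_companion_mul.
  by rewrite mulrC modp_mull poly_cV0.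
by rewrite size_polyXn ltn_ord.
Qed.

End MonicCompanion.

Section CompanionPair.
Variables (R : idomainType) (n : nat) (f g h : {poly R}).
Hypotheses (f_monic : f \is monic) (size_f : size f = n.+2).
Hypotheses (g_monic : g \is monic) (size_g : size g = n.+2).
Local Notation cV := (@poly_cV R n).
Implicit Types p q : {poly R}.
Local Notation C := (companion n f).
Local Notation D := (companion n g).

Lemma size_sub_monic : (size (f - g)%R <= n.+1)%N.
Proof.
apply/leq_sizeP => j; rewrite leq_eqVlt coefB => /predU1P[<- | lt_j].
  have /monicP := f_monic; have /monicP := g_monic.
  by rewrite !lead_coefE size_f size_g => -> ->; rewrite subrr.
by rewrite !nth_default ?size_f ?size_g ?subrr.
Qed.

Lemma horner_companion_mul_sub q p :
  horner_alg C q *m (D - C) *m cV p = p`_n *: cV ((q * (f - g)) %% f).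
Proof.
rewrite -mulmxA companion_sub_poly_cV -scalemxAr horner_companion_mul //.
exact: size_sub_monic.
Qed.

Lemma horner_companion_sub0 k :
  h * g = k * f -> horner_alg C h * (C - D) = 0.
Proof.
move=> hg; rewrite -opprB mulrN; apply/oppr_inj; rewrite opprK oppr0.
apply: mulmx_poly_cV_inj => i; rewrite horner_companion_mul_sub mul0mx.
by rewrite mulrBr hg -mulrBl modp_mull poly_cV0 scaler0.
Qed.

(** If M = sum_l b_l(C) D^l vanishes, then so does
    M D - C M = sum_l b_l(C) (D - C) D^l. Its column of index n - k involves
    only the b_l with l >= k, and for k > 0 its vanishing when b_l = 0 for all
    l > k means that f divides b_k (f - g). *)
Lemma ordered_eval_companion_inj (B : {poly {poly R}}) :
  (forall b k : {poly R}, (size b < size h)%N -> b * g = k * f -> b = 0) ->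
  normal_poly n.+1 h B -> ordered_eval B C D = 0 -> B = 0.
Proof.
move=> cancel_h [szB szB0 szBl] B0.
have M0 := B0; rewrite (ordered_eval_sum _ _ szB) in M0.
have comm0 : \sum_(l < n.+1) horner_alg C B`_l * (D - C) * D ^+ l = 0.
  pose M := \sum_(l < n.+1) horner_alg C B`_l * D ^+ l.
  transitivity (M * D - C * M); last by rewrite /M M0 mul0r mulr0 subrr.
  rewrite mulr_suml mulr_sumr -sumrB; apply: eq_bigr => l _.
  have CB : C * horner_alg C B`_l = horner_alg C B`_l * C.
    by rewrite -{1 4}(horner_algX C) -!rmorphM mulrC.
  by rewrite [C * _]mulrA CB mulrBr mulrBl -!mulrA -exprSr -exprS.
have col0 i : (i <= n)%N ->
    \sum_(l < n.+1) ('X^(l + i) %% g)`_n *: cV ((B`_l * (f - g)) %% f) = 0.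
  move=> le_in; transitivity ((0 : 'M_n.+1) *m cV 'X^i); last exact: mul0mx.
  rewrite -[X in X *m _]comm0 mulmx_suml; apply: eq_bigr => l _.
  rewrite -!mulmxE -[RHS]mulmxA companion_exp_mul //.
  by rewrite horner_companion_mul_sub.
(* By induction on m, the coefficients of index above n - m and 0 vanish; the
   column of index n - l isolates b_l. *)
have Bl0 m l : (0 < l)%N -> (n - m < l)%N -> B`_l = 0.
  elim: m l => [|m IHm] l l_gt0 lt_l.
    by rewrite nth_default // (leq_trans szB) // -(subn0 n).
  have [/IHm-> // | le_l] := ltnP (n - m) l.
  have def_l : l = (n - m)%N by lia.
  have lt_ln : (l < n.+1)%N by lia.
  have /col0 : (n - l <= n)%N by apply: leq_subr.
  have lift (i : nat) : (i <= n)%N -> ('X^i %% g : {poly R}) = 'X^i.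
    by move=> le_in; rewrite modp_small // size_polyXn size_g !ltnS.
  rewrite (bigD1 (Ordinal lt_ln)) //= big1 => [|j neq_j].
    rewrite addr0 subnKC // lift // coefXn eqxx scale1r => /poly_cV_eq0.
    move=> /(_ (size_modp_monic f_monic size_f _)) mod0.
    have := Pdiv.IdomainMonic.divp_eq f_monic (B`_l * (f - g)).
    rewrite mod0 addr0; set k := _ %/ f => def_k.
    apply: (cancel_h _ (B`_l - k)); first exact: szBl.
    by rewrite mulrBl -def_k mulrBr subKr.
  have [lt_jl | le_lj] := ltnP j l.
    by rewrite lift ?coefXn ?gtn_eqF ?scale0r //; lia.
  rewrite IHm; first by rewrite mul0r mod0p poly_cV0 scaler0.
    by lia.
  by have := neq_j; rewrite -(inj_eq val_inj) /=; lia.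
have defB : B = (B`_0)%:P.
  apply/polyP => -[|l]; rewrite coefC //=.
  by apply: (Bl0 n); rewrite ?subnn.
rewrite defB; apply/eqP; rewrite polyC_eq0; apply/eqP.
move: B0; rewrite defB ordered_evalC coefC /= => /(congr1 (mulmx^~ (cV 1))).
rewrite mul0mx horner_companion_mul ?size_poly1 // mulr1 modp_small.
  exact: poly_cV_eq0.
by rewrite size_f ltnS.
Qed.

End CompanionPair.

(** * The monic greatest common divisor *)

Section MonicGcd.
Variables (R : idomainType) (f g d : {poly R}).
Hypothesis f_monic : f \is monic.
Local Notation F := (map_poly (@tofrac R)).
Hypothesis def_d : F d = monic_gcd (F f) (F g).

Let frac_inj : injective (@tofrac R).
Proof. by move=> x y /eqP; rewrite tofrac_eq => /eqP. Qed.

Let size_F p : size (F p) = size p.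
Proof. exact: size_map_inj_poly (rmorph0 _) _. Qed.

Let F_eq0 p : (F p == 0) = (p == 0).
Proof. by rewrite -!size_poly_eq0 size_F. Qed.

Let gcd_neq0 : gcdp (F f) (F g) != 0.
Proof. by rewrite gcdp_eq0 negb_and F_eq0 monic_neq0. Qed.

Let Fd_eqp : F d %= gcdp (F f) (F g).
Proof. by rewrite def_d /monic_gcd eqp_scale // invr_eq0 lead_coef_eq0. Qed.

Lemma monic_gcd_monic : d \is monic.
Proof.
apply/monicP/frac_inj; rewrite -(lead_coef_map_inj frac_inj) ?rmorph0 //.
by rewrite def_d lead_coefZ mulVf ?lead_coef_eq0 // rmorph1.
Qed.

Let d_monic := monic_gcd_monic.

(** Division by a monic polynomial commutes with passing to fractions. *)
Lemma monic_dvdp_frac (p : {poly R}) : F d %| F p -> p = p %/ d * d.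
Proof.
have := Pdiv.IdomainMonic.divp_eq d_monic p; set r := p %% d => {1 2}->.
rewrite rmorphD rmorphM /= dvdp_addr ?dvdp_mull // => d_r.
suff -> : r = 0 by rewrite addr0.
apply: contraTeq d_r => r_neq0; apply/negP => /dvdp_leq.
by rewrite F_eq0 => /(_ r_neq0); rewrite !size_F leqNgt ltn_modp monic_neq0.
Qed.

Let h := f %/ d.

Lemma monic_gcd_dvdl : f = h * d.
Proof. by apply: monic_dvdp_frac; rewrite (eqp_dvdl _ Fd_eqp) dvdp_gcdl. Qed.

Lemma monic_gcd_dvdr : g = g %/ d * d.
Proof. by apply: monic_dvdp_frac; rewrite (eqp_dvdl _ Fd_eqp) dvdp_gcdr. Qed.

Lemma divp_monic_gcd_monic : h \is monic.
Proof. by move: f_monic; rewrite monic_gcd_dvdl monicMr. Qed.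

Lemma divp_monic_gcd_mul : h * g = g %/ d * f.
Proof.
by rewrite {1}monic_gcd_dvdr [in RHS]monic_gcd_dvdl !mulrA [h * _]mulrC.
Qed.

(** As h and g / d are coprime over the fractions, f divides b g only if h
    divides b. *)
Lemma divp_monic_gcd_cancel (b k : {poly R}) :
  (size b < size h)%N -> b * g = k * f -> b = 0.
Proof.
set g' := g %/ d => szb bg.
have d_neq0 : d != 0 by rewrite monic_neq0.
have bg' : b * g' = k * h.
  by apply: (mulIf d_neq0); rewrite -!mulrA -monic_gcd_dvdr -monic_gcd_dvdl.
have co_hg : coprimep (F h) (F g').
  apply/coprimepP => e e_h e_g.
  have : e * F d %| F d.
    rewrite (eqp_dvdr _ Fd_eqp) dvdp_gcd monic_gcd_dvdl monic_gcd_dvdr.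
    by rewrite !rmorphM !dvdp_mul.
  by rewrite -{2}[F d]mul1r dvdp_mul2r ?F_eq0 // dvdp1 size_poly_eq1.
have : F h %| F b.
  rewrite -(Gauss_dvdpl _ co_hg) -rmorphM bg' rmorphM.
  exact: dvdp_mull.
apply: contraTeq => b_neq0; apply/negP => /dvdp_leq.
by rewrite F_eq0 => /(_ b_neq0); rewrite !size_F leqNgt szb.
Qed.

End MonicGcd.

(** * The presentation *)

Section Morphisms.
Variables (R : comNzRingType) (A A' : algType R) (phi : {lrmorphism A -> A'}).

Lemma rmorph_horner_alg x p : phi (horner_alg x p) = horner_alg (phi x) p.
Proof.
elim/poly_ind: p => [|p c IHp]; first by rewrite !rmorph0.
by rewrite !rmorphD !rmorphM /= !horner_algX !horner_algC IHp rmorph_alg.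
Qed.

Lemma rmorph_ordered_eval (B : {poly {poly R}}) x y :
  phi (ordered_eval B x y) = ordered_eval B (phi x) (phi y).
Proof.
rewrite /ordered_eval rmorph_sum; apply: eq_bigr => l _.
rewrite rmorph_sum; apply: eq_bigr => k _.
by rewrite /= linearZ rmorphM !rmorphXn.
Qed.

End Morphisms.

Lemma subalg_gen_image (R : comNzRingType) (A A' : algType R)
    (phi : {lrmorphism A -> A'}) (S : A -> Prop) (S' : A' -> Prop) w :
  (forall u, S u -> S' (phi u)) -> subalg_gen S w -> subalg_gen S' (phi w).
Proof.
move=> SS'; elim=> {w} [u /SS'|c|u v _ IHu _ IHv|u v _ IHu _ IHv].
- exact: SubalgGen.
- by rewrite rmorph_alg; apply: SubalgScalar.
- by rewrite rmorphD; apply: SubalgAdd.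
- by rewrite rmorphM; apply: SubalgMul.
Qed.

Lemma free_alg_bool_gen (R : comNzRingType) (w : free_alg R bool) :
  subalg_gen (fun u => u = free_var false \/ u = free_var true) w.
Proof.
apply: (subalg_gen_image (phi := idfun)) (free_alg_gen w) => u [[] ->].
  by right.
by left.
Qed.

Theorem theorem8p4 (R : idomainType) (n : nat) (f g d : {poly R})
    (P : nat -> {poly {poly R}})
    (f_monic : f \is monic) (size_f : size f = n.+2)
    (g_monic : g \is monic) (size_g : size g = n.+2)
    (def_d : map_poly (@tofrac R) d =
       monic_gcd (map_poly (@tofrac R) f) (map_poly (@tofrac R) g))
    (C := companion n f) (D := companion n g)
    (PE : forall j, (0 < j < n.+1)%N -> D ^+ j * C = ordered_eval (P j) C D) :
  has_presentation
    (subalg_gen (fun x : 'M[R]_n.+1 => x = C \/ x = D))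
    (fun b : bool => if b then D else C)
    (relators n.+1 f g (f %/ d) P).
Proof.
set a := fun b : bool => if b then D else C; set h := f %/ d.
set rels := relators _ _ _ _ _.
pose X : free_alg R bool := free_var false.
pose Y : free_alg R bool := free_var true.
have aX : free_eval a X = C by rewrite free_eval_var.
have aY : free_eval a Y = D by rewrite free_eval_var.
have rels0 w : ideal_gen rels w -> free_eval a w = 0.
  move: w; apply: ideal_gen_ker => w [] => [-> | -> | -> | [j lt_j ->]].
  + by rewrite /= rmorph_horner_alg /= aX horner_companion.
  + by rewrite /= rmorph_horner_alg /= aY horner_companion.
  + rewrite /= rmorphM rmorphB /= rmorph_horner_alg /= aX aY.
    exact: horner_companion_sub0 (divp_monic_gcd_mul f_monic def_d).
  + rewrite /= rmorphB rmorphM rmorphXn /= rmorph_ordered_eval /= aX aY PE //.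
    by rewrite subrr.
split=> [x|w]; split.
- elim=> {x} [x [] -> | c | x y _ [u <-] _ [v <-] | x y _ [u <-] _ [v <-]].
  + by exists X.
  + by exists Y.
  + by exists c%:A; rewrite rmorph_alg.
  + by exists (u + v); rewrite rmorphD.
  + by exists (u * v); rewrite rmorphM.
- move=> [w <-]; apply: subalg_gen_image (free_alg_bool_gen w) => u.
  by case=> ->; [left | right].
- move=> w0.
  have h_monic := divp_monic_gcd_monic f_monic def_d.
  have rels_f : ideal_gen rels (horner_alg X f) by apply/IdealGen/Or41.
  have rels_g : ideal_gen rels (horner_alg Y g) by apply/IdealGen/Or42.
  have rels_h : ideal_gen rels (horner_alg X h * (X - Y)).
    exact/IdealGen/Or43.
  have rels_P j : (0 < j < n.+1)%N ->
      ideal_gen rels (Y ^+ j * X - ordered_eval (P j) X Y).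
    by move=> lt_j; apply/IdealGen/Or44; exists j.
  have [B0 JB0] := subalg_gen_ordered g_monic size_g rels_g rels_P
    (free_alg_bool_gen w).
  have [B B_normal JB] := ordered_eval_normal f_monic size_f g_monic size_g
    h_monic rels_f rels_g rels_h B0.
  have {JB0} JwB := ideal_gen_trans JB0 JB.
  suff B_eq0 : B = 0.
    by move: JwB; rewrite B_eq0 [ordered_eval 0 _ _]ordered_evalC rmorph0 subr0.
  apply: (ordered_eval_companion_inj f_monic size_f g_monic size_g) B_normal _.
    by move=> b k; apply: divp_monic_gcd_cancel f_monic def_d _ _.
  move: (rels0 _ JwB); rewrite rmorphB /= w0 sub0r rmorph_ordered_eval /= aX aY.
  by move/eqP; rewrite oppr_eq0 => /eqP.
- exact: rels0.
Qed.
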